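(* Let $K$ be a field of characteristic zero, $d\in\mathbb{N}$, $R=K[x_1,\ldots,x_d]$, $S=K[y_1,\ldots,y_d]$, and let $G'$ be the set of all monomials of $S$. Let $I$ be a monomial ideal of $R$, let $I'$ be the corresponding monomial ideal of $S$ (replace each $x_i$ by $y_i$), and let $U(I')\subseteq G'$ be the set of monomials contained in $I'$. Then the inverse system $I^{-1}=\{g'\in S : f\circ g'=0\text{ for each } f\in I\}$ is the $R$-submodule of $S$ generated by all monomials in $G'\setminus U(I')$. If moreover $I$ is zero-dimensional, then $G'\setminus U(I')=D(\partial\mathrm{oc}(I'))$, and so $I^{-1}$ is an $R$-submodule of $S$ minimally generated by $\partial\mathrm{oc}(I')$.
   Context: The ring $R$ acts $K$-linearly on $S$ by differentiation: $x_i$ acts as $\partial/\partial y_i$, so $\tilde{x}^{\tilde{p}}\circ\tilde{y}^{\tilde{q}}=0$ if $\tilde{p}\not\leq\tilde{q}$ componentwise, and $\tilde{x}^{\tilde{p}}\circ\tilde{y}^{\tilde{q}}=\prod_{i=1}^d\frac{q_i!}{(q_i-p_i)!}\,\tilde{y}^{\tilde{q}-\tilde{p}}$ if $\tilde{p}\leq\tilde{q}$. This makes $S$ an $R$-module. $G'$ is partially ordered by divisibility. For $A\subseteq G'$, $D(A)$ is the downset generated by $A$, i.e. the set of monomials dividing some element of $A$. For a monomial ideal $H$ of a polynomial ring with homogeneous maximal ideal $\mathfrak{m}$ generated by the variables, the docle $\partial\mathrm{oc}(H)$ is the set of monomials in $(H:\mathfrak{m})\setminus H$, equivalently the set of maximal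 elements (with respect to divisibility) among monomials not in $H$. Zero-dimensional means that the quotient ring is finite-dimensional over $K$. ''Minimally generated by a set'' means generated by the set but by no proper subset of it. *)

(* Defs.v *)
From HB Require Import structures.
From mathcomp Require Import all_boot all_order all_algebra.
From mathcomp Require Import ssrcomplements.
From mathcomp Require Export mpoly.

Set Implicit Arguments.
Unset Strict Implicit.
Unset Printing Implicit Defensive.

Import GRing.Theory.
Local Open Scope ring_scope.

(* Subsets are Prop-valued predicates, since the ideals in play need be neither
   proper nor decidable, as [idealr] of ring_quotient would require. *)

Section Submodules.
Variables (R : nzRingType) (V : lmodType R).
Implicit Types A B M : V -> Prop.

Definition submodule M : Prop :=
  M 0 /\ forall (a : R) (u v : V), M u -> M v -> M (a *: u + v).

Definition submod_gen A (v : V) : Prop :=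
  forall M, submodule M -> (forall u, A u -> M u) -> M v.

Definition generates A M : Prop := forall v, M v <-> submod_gen A v.

Definition included B A : Prop := forall v, B v -> A v.

Definition minimally_generates A M : Prop :=
  generates A M /\
  forall B, included B A -> ~ included A B -> ~ generates B M.

Lemma submod_gen_submodule A : submodule (submod_gen A).
Proof.
split=> [M [M0 _] _ //|a u v Hu Hv M sM AM].
by apply: sM.2; [apply: Hu | apply: Hv].
Qed.
End Submodules.

Section Ideals.
Variable R : comNzRingType.
Implicit Types A H J : R -> Prop.

Definition ideal_gen A : R -> Prop := @submod_gen R R^o A.

Definition colon H J (f : R) : Prop := forall h, J h -> H (f * h).

Definition divides (f g : R) : Prop := exists q, g = q * f.
End Ideals.

Section Monomials.
Variables (K : fieldType) (d : nat).
Implicit Types A H : {mpoly K[d]} -> Prop.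

Definition monomial (g : {mpoly K[d]}) : Prop := exists m, g = 'X_[m].

Definition monomial_ideal H : Prop :=
  exists2 A, (forall g, A g -> monomial g) & (forall f, H f <-> ideal_gen A f).

Definition max_ideal : {mpoly K[d]} -> Prop :=
  ideal_gen (fun g => exists i : 'I_d, g = 'X_i).

Definition monomials_in H (g : {mpoly K[d]}) : Prop := monomial g /\ H g.

Definition monomials_notin H (g : {mpoly K[d]}) : Prop :=
  monomial g /\ ~ monomials_in H g.

Definition downset A (g : {mpoly K[d]}) : Prop :=
  monomial g /\ exists2 a, A a & divides g a.

Definition docle H (g : {mpoly K[d]}) : Prop :=
  [/\ monomial g, colon H max_ideal g & ~ H g].

(* The quotient by H is spanned over K by the classes of finitely many b i. *)
Definition zero_dimensional H : Prop :=
  exists (n : nat) (b : 'I_n -> {mpoly K[d]}),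
    forall f, exists c : 'I_n -> K, H (f - \sum_(i < n) c i *: b i).
End Monomials.

(* K[y_1, ..., y_d], a copy of R = {mpoly K[d]}: on [dpoly K d] the scaling
   f *: g by f : {mpoly K[d]} is the differentiation action, not the product. *)
Definition dpoly (K : fieldType) (d : nat) : Type := {mpoly K[d]}.

Section DifferentialModule.
Variables (K : fieldType) (d : nat).
Implicit Types f g : {mpoly K[d]}.

Definition diffact f g : {mpoly K[d]} :=
  \sum_(p <- msupp f) f@_p *: mderivm p g.

Lemma diffactwE k f g : (msize f <= k)%N ->
  diffact f g = \sum_(p : 'X_{1..d < k}) f@_p *: mderivm p g.
Proof.
move=> le_fk; rewrite /diffact (big_mksub 'X_{1..d < k}) //=; first last.
+ by move=> x /msize_mdeg_lt/leq_trans; apply.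
+ by rewrite msupp_uniq.
rewrite big_rmcond //= => i.
by move/memN_msupp_eq0 ->; rewrite scale0r.
Qed.

Lemma diffactDl g : {morph diffact^~ g : f1 f2 / f1 + f2}.
Proof.
move=> f1 f2 /=; pose k := maxn (msize (f1 + f2)) (maxn (msize f1) (msize f2)).
rewrite !(@diffactwE k) ?leq_max ?leqnn ?orbT // -big_split /=.
by apply: eq_bigr => p _; rewrite mcoeffD scalerDl.
Qed.

Lemma diffactZl c f g : diffact (c *: f) g = c *: diffact f g.
Proof.
pose k := maxn (msize (c *: f)) (msize f).
rewrite !(@diffactwE k) ?leq_max ?leqnn ?orbT // scaler_sumr.
by apply: eq_bigr => p _; rewrite mcoeffZ scalerA.
Qed.

Lemma diffactDr f : {morph diffact f : g1 g2 / g1 + g2}.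
Proof.
move=> g1 g2; rewrite /diffact -big_split /=.
by apply: eq_bigr => p _; rewrite mderivmD scalerDr.
Qed.

Lemma diffactZr c f g : diffact f (c *: g) = c *: diffact f g.
Proof.
rewrite /diffact scaler_sumr.
by apply: eq_bigr => p _; rewrite mderivmZ !scalerA mulrC.
Qed.

Lemma diffact0l g : diffact 0 g = 0.
Proof. by rewrite /diffact msupp0 big_nil. Qed.

Lemma diffact0r f : diffact f 0 = 0.
Proof. by rewrite /diffact big1 // => p _; rewrite linear0 scaler0. Qed.

Lemma diffactXm p g : diffact 'X_[p] g = mderivm p g.
Proof. by rewrite /diffact msuppX big_seq1 mcoeffX eqxx scale1r. Qed.

Lemma diffactX i g : diffact 'X_i g = mderiv i g.
Proof. by rewrite diffactXm mderivmU1m. Qed.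

Lemma diffactXX (p q : 'X_{1..d}) :
  diffact 'X_[p] 'X_[q] =
    if (p <= q)%MM
    then (\prod_(i < d) ((q i)`! %/ (q i - p i)`!)%N)%:R *: 'X_[q - p]
    else 0.
Proof.
rewrite diffactXm mderivmX natr_prod; case: ifP => [/mnm_lepP le_pq | nle].
  rewrite natr_prod; congr (_ *: _); apply: eq_bigr => i _.
  by rewrite ffact_factd.
have /forallPn [i lt_qp] : ~~ [forall i, p i <= q i]%N.
  by apply/negP => /forallP H; move/mnm_lepP: H; rewrite nle.
by rewrite (bigD1 i) //= ffact_small ?mul0r ?scale0r // ltnNge.
Qed.

Lemma diffactA f1 f2 g : diffact f1 (diffact f2 g) = diffact (f1 * f2) g.
Proof.
have sumr h (I : Type) (r : seq I) F :
    diffact h (\sum_(i <- r) F i) = \sum_(i <- r) diffact h (F i).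
  by apply: (big_morph _ (diffactDr h) (diffact0r h)).
have suml h (I : Type) (r : seq I) F :
    diffact (\sum_(i <- r) F i) h = \sum_(i <- r) diffact (F i) h.
  by apply: (big_morph (diffact^~ h) (diffactDl h) (diffact0l h)).
rewrite [f1]mpolyE [f2]mpolyE mulr_suml !suml; apply: eq_bigr => p _.
rewrite mulr_sumr suml sumr; apply: eq_bigr => q _.
rewrite -scalerAl -scalerAr 2!(diffactZl f1@_p) 2!(diffactZl f2@_q).
rewrite (diffactZr f2@_q); congr (_ *: (_ *: _)).
by rewrite -mpolyXD !diffactXm addmC mderivmDm.
Qed.

Lemma diffact1 : left_id 1 diffact.
Proof. by move=> g; rewrite -mpolyX0 diffactXm mderivm0m. Qed.

HB.instance Definition _ := GRing.ComNzRing.copy (dpoly K d) {mpoly K[d]}.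
HB.instance Definition _ :=
  GRing.Zmodule_isLmodule.Build {mpoly K[d]} (dpoly K d)
    diffactA diffact1 diffactDr diffactDl.

Lemma dpoly_scaleE f (g : dpoly K d) : f *: g = diffact f g.
Proof. by []. Qed.

(* Replaces each x_i by y_i. *)
Definition xtoy f : dpoly K d := f \mPo [tuple 'X_i | i < d].

Definition corresponding_ideal (I : {mpoly K[d]} -> Prop) (g : dpoly K d) :
  Prop := exists2 f, I f & g = xtoy f.

Definition inverse_system (I : {mpoly K[d]} -> Prop) (g : dpoly K d) : Prop :=
  forall f, I f -> f *: g = 0.

Lemma inverse_system_submodule (I : {mpoly K[d]} -> Prop) :
  @submodule {mpoly K[d]} (dpoly K d) (inverse_system I).
Proof.
split=> [f _|a u v Hu Hv f If]; first by rewrite scaler0.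
by rewrite scalerDr scalerA mulrC -scalerA Hu // Hv // scaler0 addr0.
Qed.
End DifferentialModule.

(* Main.v *)
(** Both [I] and its inverse system are spanned over [K] by monomials.  The
    constant coefficient of [x^m o v] is [m! v_m], so in characteristic zero an
    element of the inverse system has no term in [I]; and [x^p o y^m] is a
    nonzero multiple of [y^(m-p)] when [p <= m], so a monomial generates all its
    divisors.  When [I] is zero-dimensional the monomials outside [I] have
    bounded degree, hence each of them divides a maximal one.  Finally,
    for [a] in the docle, the polynomials without any term divisible by [y^a]
    form a submodule that contains the rest of the docle but not [y^a], so
    no generator can be dropped. *)

Require Import Defs.
From mathcomp Require Import all_boot all_order all_algebra.
From Stdlib Require Import Classical FunctionalExtensionality.
From Stdlib Require Import PropExtensionality.

Set Implicit Arguments.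
Unset Strict Implicit.
Unset Printing Implicit Defensive.

Import GRing.Theory.
Local Open Scope ring_scope.

(** * Closure properties of submodules *)

Section SubmoduleTheory.
Variables (R : nzRingType) (V : lmodType R).
Implicit Types (A M : V -> Prop) (u v : V).

Lemma submoduleZ M (a : R) u : submodule M -> M u -> M (a *: u).
Proof. by move=> [M0 MD] Mu; rewrite -[_ *: _]addr0; apply: MD. Qed.

Lemma submoduleD M u v : submodule M -> M u -> M v -> M (u + v).
Proof. by move=> [_ MD] Mu Mv; rewrite -[u]scale1r; apply: MD. Qed.

Lemma submodule_sum M (T : eqType) (r : seq T) (F : T -> V) :
  submodule M -> (forall i, i \in r -> M (F i)) -> M (\sum_(i <- r) F i).
Proof.
move=> sM MF; rewrite big_seq; elim/big_rec: _ => [|i v ri Mv].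
  exact: sM.1.
by apply: submoduleD => //; apply: MF.
Qed.

Lemma submod_gen_incl A v : A v -> submod_gen A v.
Proof. by move=> Av M _; apply. Qed.
End SubmoduleTheory.

(** * Monomial ideals, their docles and zero-dimensionality *)

Section MonomialIdeals.
Variables (K : fieldType) (d : nat).
Implicit Types (H : {mpoly K[d]} -> Prop) (m a : 'X_{1..d}).

Lemma monomial_ideal_submodule H :
  monomial_ideal H -> @submodule {mpoly K[d]} {mpoly K[d]}^o H.
Proof.
move=> [A _ HA].
have [g0 gD] := @submod_gen_submodule {mpoly K[d]} {mpoly K[d]}^o A.
split=> [|f u v /HA Hu /HA Hv]; first exact/HA.
by apply/HA; apply: gD.
Qed.

Lemma monomial_idealM H f g : monomial_ideal H -> H g -> H (f * g).
Proof. by move/monomial_ideal_submodule; apply: submoduleZ. Qed.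

Lemma monomial_ideal_lem H m a :
  monomial_ideal H -> (m <= a)%MM -> H 'X_[m] -> H 'X_[a].
Proof.
by move=> mH le_ma Hm; rewrite -(submK le_ma) mpolyXD; apply: monomial_idealM.
Qed.

(** The polynomials all of whose terms lie in [H] form an ideal containing the monomial generators
    of [H]. *)
Lemma monomial_ideal_msupp H f m :
  monomial_ideal H -> H f -> m \in msupp f -> H 'X_[m].
Proof.
move=> mH Hf; move: m; have [A Amon HA] := mH.
have /HA genf := Hf.
apply: (genf (fun f => forall m, m \in msupp f -> H 'X_[m])).
  split=> [m|g u v Hu Hv m]; first by rewrite msupp0.
  move/msuppD_le; rewrite mem_cat => /orP[|/Hv //].
  move/msuppM_le/allpairsP=> [[m1 m2] /= [_ /Hu Hm2 ->]].
  by rewrite mpolyXD; apply: monomial_idealM.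
move=> u Au m; have [k uE] := Amon u Au.
rewrite uE msuppX inE => /eqP ->.
by rewrite -uE; apply/HA; apply: submod_gen_incl.
Qed.

Lemma lem_divides m a :
  (m <= a)%MM -> divides ('X_[m] : {mpoly K[d]}) 'X_[a].
Proof. by move=> le_ma; exists 'X_[a - m]; rewrite -mpolyXD submK. Qed.

(** The polynomials multiplying ['X_[a]] into [H] form an ideal, so testing the variables
    suffices. *)
Lemma docleXP H a :
  monomial_ideal H ->
  docle H 'X_[a] <-> ~ H 'X_[a] /\ forall i, H 'X_[a + U_(i)].
Proof.
move=> mH; split=> [[_ colon_a nHa]|[nHa Ha]].
  split=> // i; rewrite mpolyXD; apply: colon_a.
  by apply: (@submod_gen_incl _ {mpoly K[d]}^o); exists i.
split=> //; first by exists a.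
move=> h gen_h.
apply: (gen_h (fun h => H ('X_[a] * h))) => [|_ [i ->]].
  split=> [|f u v Hu Hv].
    by rewrite mulr0; exact: (monomial_ideal_submodule mH).1.
  rewrite mulrDr [_ *: _]/(f * u) mulrCA.
  exact: (monomial_ideal_submodule mH).2.
by rewrite -mpolyXD.
Qed.

(* Among n + 1 powers of a variable, n being the number of elements spanning the
   quotient, some nontrivial combination lies in H; hence one of them does. *)
Lemma zero_dimensional_bound H :
  monomial_ideal H -> zero_dimensional H ->
  exists N, forall m, ~ H 'X_[m] -> (mdeg m <= N)%N.
Proof.
(* Each exponent is at most [n]: otherwise some power of a variable, with exponent at most [n], lies
   in [H] and divides ['X_[m]]. *)
move=> mH [n [b bP]]; exists (\sum_(i < d) n)%N => m nHm.
rewrite mdegE; apply: leq_sum => i _; rewrite leqNgt; apply/negP => lt_n_mi.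
apply: nHm.
have [c cP] : exists c : 'I_n.+1 -> 'I_n -> K, forall j : 'I_n.+1,
    H ('X_[U_(i) *+ j] - \sum_(k < n) c j k *: b k).
  have [c cP] := fin_all_exists (fun j : 'I_n.+1 => bP 'X_[U_(i) *+ j]).
  by exists c.
pose C := \matrix_(j < n.+1, k < n) c j k.
(* [C] has [n.+1] rows and rank at most [n], so its left kernel is nonzero. *)
have [u u_neq0 uC] : exists2 u : 'rV_n.+1, u != 0 & u *m C = 0.
  have /rowV0Pn[u uker u_neq0] : kermx C != 0.
    rewrite kermx_eq0 /row_free neq_ltn; apply/orP; left.
    by rewrite ltnS; apply: rank_leq_col.
  by exists u => //; apply/sub_kermxP.
pose f := \sum_j u 0 j *: ('X_[U_(i) *+ j] : {mpoly K[d]}).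
have Hf : H f.
  (* The multiples of each [b k] cancel because [u *m C = 0]. *)
  have -> : f = \sum_j u 0 j *: ('X_[U_(i) *+ j] - \sum_(k < n) c j k *: b k).
    under [RHS]eq_bigr do rewrite scalerBr.
    rewrite sumrB [X in _ - X](_ : _ = 0) ?subr0 //.
    under eq_bigr do rewrite scaler_sumr.
    rewrite exchange_big big1 // => k _.
    under eq_bigr do rewrite scalerA.
    have : (u *m C) 0 k = 0 by rewrite uC mxE.
    rewrite mxE => uCk; rewrite -scaler_suml -[RHS](scale0r (b k)) -[in RHS]uCk.
    by congr (_ *: _); apply: eq_bigr => j _; rewrite mxE.
  apply: (@submodule_sum _ {mpoly K[d]}^o) => [|j _].
    exact: monomial_ideal_submodule.
  by rewrite -mul_mpolyC; apply: monomial_idealM.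
have [j uj] : exists j, u 0 j != 0.
  by have /matrix0Pn[r [j]] := u_neq0; rewrite ord1; exists j.
(* Distinct exponents give distinct monomials, so ['X_[U_(i) *+ j]] has coefficient [u 0 j] in
   [f]. *)
have Hj : H 'X_[U_(i) *+ j].
  apply: (monomial_ideal_msupp mH Hf).
  rewrite mcoeff_msupp /f raddf_sum (bigD1 j) //= big1 ?addr0 => [|k ne_kj].
    by rewrite mcoeffZ mcoeffX eqxx mulr1.
  rewrite mcoeffZ mcoeffX (_ : _ == _ = false) ?mulr0 //.
  apply/negP => /eqP/(congr1 (fun p : 'X_{1..d} => p i)).
  rewrite !mulmnE mnm1E eqxx !mul1n => /val_inj kj.
  by rewrite kj eqxx in ne_kj.
apply: monomial_ideal_lem Hj => //; apply/mnm_lepP => k.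
rewrite mulmnE mnm1E; case: eqP => [<-|_]; last by rewrite mul0n.
by rewrite mul1n (leq_trans _ (ltnW lt_n_mi)) // -ltnS.
Qed.

(** Multiplying by variables while staying outside [H] must stop, as degrees there are bounded; the
    last monomial reached is in the docle. *)
Lemma docle_above H m :
  monomial_ideal H -> zero_dimensional H -> ~ H 'X_[m] ->
  exists2 a, (m <= a)%MM & docle H 'X_[a].
Proof.
move=> mH /(zero_dimensional_bound mH)[N bound].
have [k] := ubnP (N - mdeg m)%N; elim: k m => // k IHk m lt_k nHm.
have [Hall|/not_all_ex_not[i nHi]] := classic (forall i, H 'X_[m + U_(i)]).
  by exists m; [apply: lepm_refl | apply/docleXP].
have [|a le_a doc_a] := IHk (m + U_(i))%MM _ nHi.
  have := bound _ nHi; rewrite mdegD mdeg1 addn1 => lt_mN.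
  by rewrite -ltnS (leq_trans _ lt_k) // ltnS ltn_sub2l.
by exists a => //; apply: lepm_trans le_a; apply: lem_addr.
Qed.

Lemma monomials_notinE H g :
  monomials_notin H g <-> exists2 m, g = 'X_[m] & ~ H 'X_[m].
Proof.
split=> [[[m ->] nHm]|[m -> nHm]].
  by exists m => // Hm; apply: nHm; split=> //; exists m.
by split; [exists m | case].
Qed.

Lemma monomials_notin_downset H g :
  monomial_ideal H -> zero_dimensional H ->
  monomials_notin H g <-> downset (docle H) g.
Proof.
move=> mH zH; rewrite monomials_notinE; split=> [[m -> nHm]|].
  have [a le_ma doc_a] := docle_above mH zH nHm.
  split; first by exists m.
  by exists 'X_[a] => //; apply: lem_divides.
move=> [[m ->] [a [_ _ nHa] [q aE]]]; exists m => // Hm.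
by apply: nHa; rewrite aE; apply: monomial_idealM.
Qed.
End MonomialIdeals.

(** * The inverse system and its generators *)

Section InverseSystem.
Variables (K : fieldType) (d : nat).
Implicit Types (H : {mpoly K[d]} -> Prop) (m a p : 'X_{1..d}).
Implicit Types u v : dpoly K d.

Lemma mcoeff_diffact_eq0 (f u : {mpoly K[d]}) m :
  (forall p, p \in msupp f -> u@_(p + m) = 0) -> (diffact f u)@_m = 0.
Proof.
move=> u0; rewrite /diffact raddf_sum big_seq big1 // => p /u0 up0.
by rewrite /= mcoeffZ mcoeff_mderivm up0 mul0rn mulr0.
Qed.

(** Scaling on [dpoly] is by polynomials; the constants among them recover the scalars of [K]. *)
Lemma diffactC c u : diffact c%:MP u = c *: (u : {mpoly K[d]}).
Proof. by rewrite -[c%:MP]mulr1 mul_mpolyC diffactZl diffact1. Qed.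

(** Differentiation only lowers exponents, so a multiple of ['X_[a]] can arise only from terms that
    are themselves multiples of it. *)
Lemma submodule_mcoeff_eq0 a :
  @submodule {mpoly K[d]} (dpoly K d)
    (fun u => forall m, (a <= m)%MM -> (u : {mpoly K[d]})@_m = 0).
Proof.
split=> [m _|f u v u0 v0 m le_am]; first exact: mcoeff0.
rewrite dpoly_scaleE [_ + _]/((_ : {mpoly K[d]}) + v) mcoeffD v0 // addr0.
apply: mcoeff_diffact_eq0 => p _; apply: u0.
exact: lepm_trans le_am (lem_addl _ _).
Qed.

Lemma inverse_systemX H m :
  monomial_ideal H -> ~ H 'X_[m] -> inverse_system H ('X_[m] : dpoly K d).
Proof.
move=> mH nHm f Hf; apply/mpolyP => k; rewrite dpoly_scaleE mcoeff0.
apply: mcoeff_diffact_eq0 => p fp; rewrite mcoeffX; case: eqP => // mE.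
case: nHm; rewrite mE; apply: monomial_ideal_lem (lem_addr p k) _ => //.
exact: monomial_ideal_msupp fp.
Qed.

Hypothesis charK : [pchar K] =i pred0.

Lemma natr_char0_neq0 n : (0 < n)%N -> n%:R != 0 :> K.
Proof. by move=> n_gt0; rewrite (pcharf0P K).1 // -lt0n. Qed.

Lemma inverse_system_msupp H v m :
  inverse_system H v -> m \in msupp (v : {mpoly K[d]}) -> ~ H 'X_[m].
Proof.
move=> Hv vm /Hv/(congr1 (fun g : {mpoly K[d]} => g@_0%MM)).
rewrite /= dpoly_scaleE diffactXm mcoeff_mderivm mcoeff0 addm0 => /eqP.
rewrite -mulr_natr mulf_eq0; move: vm; rewrite mcoeff_msupp => /negbTE -> /=.
apply/negP.
by apply/natr_char0_neq0/prodn_gt0 => i; rewrite ffact_gt0.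
Qed.

Lemma submoduleX_lem (M : dpoly K d -> Prop) m a :
  @submodule {mpoly K[d]} (dpoly K d) M ->
  (m <= a)%MM -> M 'X_[a] -> M 'X_[m].
Proof.
move=> sM le_ma Ma.
have := submoduleZ 'X_[a - m] sM Ma.
rewrite dpoly_scaleE diffactXX lem_subr.
rewrite (_ : a - (a - m) = m)%MM; last by rewrite submBA // addmC addmK.
(* [n] is the product of the quotients of [(a i)!] by [(m i)!]. *)
set n := (\prod_(i < d) _)%N => Mn.
have n_neq0 : n%:R != 0 :> K.
  apply/natr_char0_neq0/prodn_gt0 => i.
  by rewrite divn_gt0 ?fact_gt0 // leq_fact // leq_subr.
have := submoduleZ ((n%:R^-1)%:MP) sM Mn.
by rewrite dpoly_scaleE diffactC scalerA mulVf // scale1r.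
Qed.

(** Serves both generation claims: [A] is either all monomials outside [H] or the docle. *)
Lemma inverse_system_generates H (A : dpoly K d -> Prop) :
  monomial_ideal H -> included A (monomials_notin H) ->
  (forall m, ~ H 'X_[m] -> exists2 a, (m <= a)%MM & A 'X_[a]) ->
  @generates {mpoly K[d]} (dpoly K d) A (inverse_system H).
Proof.
move=> mH subA coverA v; split=> [Hv M sM AM|]; last first.
  apply; first exact: inverse_system_submodule.
  move=> u /subA/monomials_notinE[m -> nHm]; exact: inverse_systemX.
rewrite [v]mpolyE; apply: (@submodule_sum _ (dpoly K d)) => // m vm.
rewrite -diffactC; apply: (submoduleZ _ sM).
have [a le_ma Aa] := coverA m (inverse_system_msupp Hv vm).
by apply: submoduleX_lem le_ma _ => //; apply: AM.
Qed.

Lemma docle_minimally_generates H :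
  monomial_ideal H -> zero_dimensional H ->
  @minimally_generates {mpoly K[d]} (dpoly K d) (docle H) (inverse_system H).
Proof.
move=> mH zH; split.
  apply: inverse_system_generates => // [u [[m ->] _ nHm]|m].
    by apply/monomials_notinE; exists m.
  exact: docle_above.
move=> B subB nsub genB; apply: nsub => g doc_g; apply: NNPP => nBg.
have [[a gE] _ _] := doc_g; subst g.
have [nHa _] := (docleXP a mH).1 doc_g.
(* ['X_[a]] lies in every submodule containing [B]; the one chosen here omits it. *)
have /genB/(_ _ (submodule_mcoeff_eq0 a)) gen := inverse_systemX mH nHa.
have /eqP : ('X_[a] : {mpoly K[d]})@_a = 0.
  apply: (gen _ a (lepm_refl a)) => u Bu m le_am.
  have doc_u := subB u Bu; have [[b uE] _ _] := doc_u; subst u.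
  have [nHb _] := (docleXP b mH).1 doc_u.
  rewrite mcoeffX; case: eqP => // bm; subst m; case: nHb.
  (* Here [a] divides [b], and strictly, because ['X_[b]] is in [B] and ['X_[a]] is not; so ['X_[b]]
     is a multiple of some ['X_[a + U_(i)]], which lies in [H]. *)
  have [i lt_ai] : exists i, (a i < b i)%N.
    apply/existsP; rewrite -[[exists _, _]]negbK negb_exists.
    apply/negP => /forallP le_ba; apply: nBg.
    suff -> : a = b by [].
    apply/mnmP => i; apply/eqP.
    by rewrite eqn_leq (mnm_lepP le_am) leqNgt le_ba.
  apply: monomial_ideal_lem (((docleXP a mH).1 doc_g).2 i) => //.
  apply/mnm_lepP => k; rewrite mnmDE mnm1E.
  case: eqP => [<-|_]; first by rewrite addn1.
  by rewrite addn0 (mnm_lepP le_am).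
by rewrite mcoeffX eqxx oner_eq0.
Qed.
End InverseSystem.

(** Both rings have the polynomials [{mpoly K[d]}] as carrier, so renaming the variables is the
    identity substitution. *)
Lemma corresponding_idealE (K : fieldType) (d : nat)
    (I : {mpoly K[d]} -> Prop) : corresponding_ideal I = I.
Proof.
apply: functional_extensionality => g; apply: propositional_extensionality.
split=> [[f If ->]|Ig]; first by rewrite /xtoy comp_mpoly_id.
by exists g; rewrite // /xtoy comp_mpoly_id.
Qed.

Theorem corollary3p7 (K : fieldType) (hK : [pchar K] =i pred0) (d : nat)
    (I : {mpoly K[d]} -> Prop) (hI : monomial_ideal I) :
  let I' : dpoly K d -> Prop := corresponding_ideal I in
  @generates {mpoly K[d]} (dpoly K d) (monomials_notin I') (inverse_system I)
  /\ (zero_dimensional I ->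
      (forall g : dpoly K d, monomials_notin I' g <-> downset (docle I') g)
      /\ @minimally_generates {mpoly K[d]} (dpoly K d)
           (docle I') (inverse_system I)).
Proof.
rewrite /= corresponding_idealE; split=> [|zI].
  apply: inverse_system_generates => // m nIm; exists m; first exact: lepm_refl.
  by apply/monomials_notinE; exists m.
split=> [g|]; first exact: monomials_notin_downset.
exact: docle_minimally_generates.
Qed.
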